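(* The following inequality holds for all $m\geq2$: \[\mathrm{Tv}(\mathbb{Z}^3, m) \leq 24m- 31.\]
   Context: For $S\subseteq\mathbb{R}^d$ and an integer $m\geq 2$, the Tverberg number $\mathrm{Tv}(S,m)$ is the smallest positive integer $n$ such that any multiset of $n$ points in $S$ admits a partition into $m$ submultisets $A_1,\dots,A_m$ with $\left(\bigcap_{i=1}^m\mathrm{conv}(A_i)\right)\cap S\neq\varnothing$ (and $\mathrm{Tv}(S,m)=\infty$ if no such number exists). *)

(* Defs.v *)
From HB Require Import structures.
From mathcomp Require Import all_boot all_order all_algebra.
From mathcomp Require Import reals.
Set Implicit Arguments. Unset Strict Implicit. Unset Printing Implicit Defensive.
Import Order.TTheory GRing.Theory Num.Theory.
Local Open Scope ring_scope.

Definition lat (R : realType) (d : nat) (p : 'rV[int]_d) : 'rV[R]_d :=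
  map_mx (fun k : int => k%:~R) p.

Definition in_conv_part (R : realType) (d n m : nat)
    (x : 'I_n -> 'rV[R]_d) (f : 'I_n -> 'I_m) (j : 'I_m) (y : 'rV[R]_d) : Prop :=
  exists w : 'I_n -> R,
    [/\ forall i, 0 <= w i,
        forall i, f i != j -> w i = 0,
        \sum_(i < n) w i = 1
      & \sum_(i < n) w i *: x i = y].

(* Tverberg property for S = Z^d (as a subset of R^d), m parts, n points:
   every multiset of n points of Z^d (a family x : 'I_n -> Z^d, repetitions
   allowed) has a partition into m submultisets (an assignment f : 'I_n -> 'I_m)
   whose convex hulls have a common point lying in Z^d. *)
Definition tverberg_Zd_prop (R : realType) (d m n : nat) : Prop :=
  forall x : 'I_n -> 'rV[int]_d,
    exists f : 'I_n -> 'I_m,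
      exists z : 'rV[int]_d,
        forall j : 'I_m, in_conv_part (fun i => lat R (x i)) f j (lat R z).

(* Tv(Z^d, m) <= N : the least positive n with the Tverberg property exists
   and is at most N, i.e. some positive n <= N has the property. *)
Definition Tv_Zd_le (R : realType) (d m N : nat) : Prop :=
  exists n : nat, [/\ (0 < n)%N, (n <= N)%N & tverberg_Zd_prop R d m n].

(* Main.v *)
Require Import Defs.
From mathcomp Require Import boolp classical_sets reals topology normedtype derive.
From mathcomp Require Import all_boot all_order all_algebra.
From mathcomp Require Import ring lra zify.
Set Implicit Arguments. Unset Strict Implicit. Unset Printing Implicit Defensive.
Import Order.TTheory GRing.Theory Num.Theory numFieldNormedType.Exports.
Local Open Scope ring_scope.

(** Call a point [p] of depth [k] in a family of points if it remains in the convex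
hull after the removal of fewer than [k] of them. Doignon's theorem (Helly number
[2 ^ d] for the lattice) yields, among more than [8 * (3 * m - 4)] points of [Z^3],
a lattice point [p] of depth [3 * (m - 1)]. Removing the vertices of a minimal
simplex containing [p] lowers the depth by at most 3, so [m - 2] simplices can be
removed greedily, leaving a family in which [p] has depth 3. It remains to split this
family into two parts whose hulls both contain [p].

If that were impossible, every set with [p] in its hull would have at least four
elements. Among the simplices [T] containing [p], take one for which the hull of the
remaining points is nearest to [p]. Exchange arguments then produce eight points:
the vertices [a, e 0, e 1, e 2] of [T], three points [b 0, b 1, b 2] whose hull
contains the nearest point, and a further point [a']. Their sign patterns in the
basis [e] are so rigid that they split into two simplices containing [p]. *)

(** * Convex hulls of finite families *)

Definition dot (R : pzRingType) d (u x : 'rV[R]_d) : R := \sum_k u 0 k * x 0 k.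

Lemma dotC (R : comPzRingType) d (u x : 'rV[R]_d) : dot u x = dot x u.
Proof. by apply: eq_bigr => k _; rewrite mulrC. Qed.

Lemma dotDr (R : pzRingType) d (u x y : 'rV[R]_d) :
  dot u (x + y) = dot u x + dot u y.
Proof. by rewrite -big_split; apply: eq_bigr => k _; rewrite mxE mulrDr. Qed.

Lemma dotBr (R : pzRingType) d (u x y : 'rV[R]_d) :
  dot u (x - y) = dot u x - dot u y.
Proof. by rewrite -sumrB; apply: eq_bigr => k _; rewrite !mxE mulrBr. Qed.

Lemma dot0r (R : pzRingType) d (u : 'rV[R]_d) : dot u 0 = 0.
Proof. by apply: big1 => k _; rewrite mxE mulr0. Qed.

Lemma dot0l (R : pzRingType) d (x : 'rV[R]_d) : dot 0 x = 0.
Proof. by apply: big1 => k _; rewrite mxE mul0r. Qed.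

Lemma dotNl (R : pzRingType) d (u x : 'rV[R]_d) : dot (- u) x = - dot u x.
Proof. by rewrite -sumrN; apply: eq_bigr => k _; rewrite mxE mulNr. Qed.

Lemma dotZr (R : comPzRingType) d a (u x : 'rV[R]_d) :
  dot u (a *: x) = a * dot u x.
Proof.
by rewrite /dot mulr_sumr; apply: eq_bigr => k _; rewrite mxE mulrCA.
Qed.

Lemma dot_sumr (R : comPzRingType) d n (u : 'rV[R]_d) (w : 'I_n -> R) v :
  dot u (\sum_i w i *: v i) = \sum_i w i * dot u (v i).
Proof.
rewrite (big_morph _ (dotDr u) (dot0r u)).
by apply: eq_bigr => i _; rewrite dotZr.
Qed.

Lemma dot_ge0 (R : realDomainType) d (x : 'rV[R]_d) : 0 <= dot x x.
Proof. by apply: sumr_ge0 => k _; rewrite -expr2 sqr_ge0. Qed.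

Lemma dot_eq0 (R : realDomainType) d (x : 'rV[R]_d) : (dot x x == 0) = (x == 0).
Proof.
apply/idP/eqP => [|->]; last by rewrite dot0r.
rewrite psumr_eq0 => [/allP x0|k _]; last by rewrite -expr2 sqr_ge0.
apply/rowP => k; rewrite mxE; apply/eqP.
by have := x0 k (mem_index_enum _); rewrite -expr2 sqrf_eq0.
Qed.

Definition hull (R : numDomainType) d n (v : 'I_n -> 'rV[R]_d) (S : {set 'I_n})
    (y : 'rV[R]_d) : Prop :=
  exists w : 'I_n -> R,
    [/\ forall i, 0 <= w i, forall i, i \notin S -> w i = 0,
        \sum_i w i = 1 & \sum_i w i *: v i = y].

Lemma hullS (R : numDomainType) d n (v : 'I_n -> 'rV[R]_d) (S T : {set 'I_n}) y :
  S \subset T -> hull v S y -> hull v T y.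
Proof.
move=> /subsetP sST [w [w0 wS w1 wv]]; exists w; split=> // i iT.
by apply: wS; apply: contra iT; apply: sST.
Qed.

Lemma hull_exists (R : numDomainType) d n (v : 'I_n -> 'rV[R]_d)
    (S : {set 'I_n}) y :
  hull v S y -> exists i, i \in S.
Proof.
move=> [w [_ wS w1 _]]; have [S0|] := set_0Vmem S; last by case=> i; exists i.
have := oner_neq0 R.
by rewrite -w1 big1 ?eqxx // => i _; rewrite wS // S0 inE.
Qed.

Lemma hull1 (R : numDomainType) d n (v : 'I_n -> 'rV[R]_d) (S : {set 'I_n}) i :
  i \in S -> hull v S (v i).
Proof.
move=> iS; exists (fun j => (j == i)%:R); split.
- by move=> j; rewrite ler0n.
- by move=> j; case: eqP => // ->; rewrite iS.
- by rewrite (bigD1 i) //= eqxx big1 ?addr0 // => j /negPf->.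
- rewrite (bigD1 i) //= eqxx scale1r big1 ?addr0 // => j /negPf->.
  by rewrite scale0r.
Qed.

Lemma hull_convex (R : numDomainType) d n (v : 'I_n -> 'rV[R]_d)
    (S : {set 'I_n}) y z t :
  0 <= t <= 1 -> hull v S y -> hull v S z -> hull v S ((1 - t) *: y + t *: z).
Proof.
move=> /andP[t0 t1] [w [w0 wS w1 wv]] [w' [w'0 w'S w'1 w'v]].
exists (fun i => (1 - t) * w i + t * w' i); split.
- by move=> i; rewrite addr_ge0 ?mulr_ge0 // subr_ge0.
- by move=> i iS; rewrite wS ?w'S // !mulr0 addr0.
- by rewrite big_split /= -!mulr_sumr w1 w'1 !mulr1 subrK.
- rewrite -wv -w'v !scaler_sumr -big_split /=; apply: eq_bigr => i _.
  by rewrite [LHS]scalerDl !scalerA.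
Qed.

(** The admissible weights form a compact set, so the norm attains its minimum on the hull; if the
    inequality failed at [v i], a step from [y] towards [v i] would decrease the norm. *)
Lemma hull_min (R : realType) d n (v : 'I_n -> 'rV[R]_d) (S : {set 'I_n}) :
  S != set0 ->
  exists2 y, hull v S y & forall i, i \in S -> dot y y <= dot y (v i).
Proof.
case/set0Pn=> i0 i0S.
pose W (w : 'rV[R]_n) := \sum_i w 0 i *: v i.
pose box : classical_sets.set 'rV[R]_n := fun w =>
  forall i, (if i \in S then `[0, 1]%classic else `[0, 0]%classic) (w ord0 i).
pose A : classical_sets.set 'rV[R]_n := fun w => box w /\ \sum_i w 0 i = 1.
have hullA w : A w -> hull v S (W w).
  move=> [wb w1]; exists (fun i => w 0 i); split=> // i.
    by have := wb i; case: ifP => _; rewrite /= in_itv /= => /andP[].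
  move=> /negPf iS; have := wb i; rewrite iS /= in_itv /= => wi.
  by apply/eqP; rewrite eq_le andbC.
have Ahull z : hull v S z -> exists2 w, A w & W w = z.
  move=> [w [w0 wS w1 wv]]; exists (\row_i w i); last first.
    by rewrite -wv; apply: eq_bigr => i _; rewrite mxE.
  split; last by rewrite -w1; apply: eq_bigr => i _; rewrite mxE.
  move=> i; rewrite mxE; case: ifPn => iS /=; rewrite in_itv /=.
    by rewrite w0 -w1 (bigD1 i) //= lerDl sumr_ge0.
  by rewrite wS ?lexx.
have contsum m (F : 'I_m -> 'rV[R]_n -> R) : (forall i, continuous (F i)) ->
    continuous (fun w => \sum_i F i w).
  by move=> cF; apply: continuous_big => //; apply: add_continuous.
have cA : compact A.
  apply: compact_closedI.
    apply: (rV_compact (A := fun i => if i \in S then _ else _)) => i.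
    by case: ifP => _; apply: segment_compact.
  apply: (@preimage_closed _ _ (fun w : 'rV[R]_n => \sum_i w 0 i) _ _ (@closed_eq R 1)).
  by move=> w _; apply: contsum => i; apply: coord_continuous.
have cW k : continuous (fun w : 'rV[R]_n => W w 0 k).
  rewrite (_ : (fun w => _) = fun w : 'rV[R]_n => \sum_i w 0 i * v i 0 k).
    apply: contsum => i w; apply: continuousM; last exact: cst_continuous.
    exact: coord_continuous.
  by apply/funext => w; rewrite summxE; apply: eq_bigr => i _; rewrite mxE.
have cf : continuous (fun w => dot (W w) (W w)).
  by apply: contsum => k w; apply: continuousM; apply: cW.
have [|w /set_mem wA wmin] := EVT_min_rV _ cA (continuous_subspaceT cf).
  by have [w wA _] := Ahull _ (hull1 v i0S); exists w.
exists (W w); first exact: hullA.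
move=> i iS; rewrite leNgt; apply/negP => lt_iy.
set y := W w in lt_iy wmin *.
pose D := dot y y - dot y (v i).
pose q := dot (v i - y) (v i - y).
have D0 : 0 < D by rewrite subr_gt0.
have q0 : 0 <= q by apply: dot_ge0.
(* The squared norm after a step [t] is [dot y y - t * (D *+ 2 - t * q)]; this [t] lies in the unit
   interval and satisfies [t * q < D]. *)
pose t := D / (D + q).
have Dq0 : 0 < D + q by rewrite ltr_wpDr.
have t0 : 0 < t by rewrite divr_gt0.
have t01 : 0 <= t <= 1.
  by rewrite (ltW t0) /t ler_pdivrMr // mul1r lerDl.
have [w' w'A w'z] := Ahull _ (hull_convex t01 (hullA _ wA) (hull1 v iS)).
have := wmin w' (mem_set w'A); rewrite w'z.
have -> : (1 - t) *: W w + t *: v i = y + t *: (v i - y).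
  by rewrite scalerBl scale1r scalerBr addrAC addrA.
have -> : dot (y + t *: (v i - y)) (y + t *: (v i - y)) =
    dot y y - t * (D *+ 2 - t * q).
  rewrite !dotDr ![dot (y + _) _]dotC !dotDr ?dotZr !(dotC (_ *: _)) !dotZr.
  by rewrite /D /q !dotBr ![dot (_ - _) _]dotC !dotBr (dotC (v i) y); ring.
rewrite lerDl oppr_ge0 (pmulr_rle0 _ t0) subr_le0 leNgt => /negP; apply.
rewrite /t mulrAC ltr_pdivrMr // -subr_gt0.
by rewrite (_ : _ - _ = D * D *+ 2 + D * q); [nra | ring].
Qed.

(** * Separation, minimal simplices and depth *)

Lemma hull_pos (R : numDomainType) d n (v : 'I_n -> 'rV[R]_d) (S : {set 'I_n}) u :
  hull v S 0 -> (forall i, i \in S -> 0 < dot u (v i)) -> False.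
Proof.
move=> [w [w0 wS w1 wv]] uS.
have /eqP : \sum_i w i * dot u (v i) = 0 by rewrite -dot_sumr wv dot0r.
rewrite psumr_eq0 => [/allP wu|i _]; last first.
  have [iS|iS] := boolP (i \in S); last by rewrite wS // mul0r.
  by rewrite mulr_ge0 // ltW // uS.
have := oner_neq0 R; rewrite -w1 big1 ?eqxx // => i _.
have [iS|iS] := boolP (i \in S); last by rewrite wS.
have := wu i (mem_index_enum _).
by rewrite /= mulf_eq0 (gt_eqF (uS i iS)) orbF => /eqP.
Qed.

(** The point of the hull nearest to 0 is a separating normal; for empty [S] any nonzero vector
    serves, whence the positive dimension. *)
Lemma hull_sep (R : realType) d n (v : 'I_n -> 'rV[R]_d.+1) (S : {set 'I_n}) :
  ~ hull v S 0 ->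
  exists2 u, u != 0 & forall i, i \in S -> 0 < dot u (v i).
Proof.
move=> S0; have [->|Sn] := eqVneq S set0.
  exists (const_mx 1) => [|i]; last by rewrite inE.
  apply/eqP => /rowP /(_ 0); rewrite !mxE => /eqP; apply/negP.
  exact: oner_neq0.
have [y yS ymin] := hull_min v Sn; have [y0|yn] := eqVneq y 0.
  by case: S0; rewrite -y0.
exists y => // i iS; apply: lt_le_trans (ymin i iS).
by rewrite lt_def dot_eq0 yn dot_ge0.
Qed.

Lemma hull_cone (R : numFieldType) d n (v : 'I_n -> 'rV[R]_d) (S : {set 'I_n}) w i :
  (forall i, 0 <= w i) -> (forall i, i \notin S -> w i = 0) ->
  0 < w i -> \sum_i w i *: v i = 0 -> hull v S 0.
Proof.
move=> w0 wS wi wv; pose s := \sum_i w i.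
have s0 : 0 < s by rewrite /s (bigD1 i) //= ltr_wpDr // sumr_ge0.
exists (fun j => s^-1 * w j); split.
- by move=> j; rewrite mulr_ge0 // invr_ge0 ltW.
- by move=> j jS; rewrite wS // mulr0.
- by rewrite -mulr_sumr mulVf // gt_eqF.
- under eq_bigr do rewrite -scalerA.
  by rewrite -scaler_sumr wv scaler0.
Qed.

(** The weighted mean of the slacks [dot u (v i) - dot u y] is zero, so no weight falls on a point
    with positive slack. *)
Lemma hull_face (R : numDomainType) d n (v : 'I_n -> 'rV[R]_d) (S : {set 'I_n}) y u :
  hull v S y -> (forall i, i \in S -> dot u y <= dot u (v i)) ->
  hull v [set i in S | dot u (v i) == dot u y] y.
Proof.
move=> [w [w0 wS w1 wv]] uS; exists w; split=> // i.
have /eqP : \sum_i w i * (dot u (v i) - dot u y) = 0.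
  under eq_bigr do rewrite mulrBr.
  by rewrite sumrB -dot_sumr -mulr_suml w1 mul1r wv subrr.
rewrite psumr_eq0 => [/allP wu|j _]; last first.
  have [jS|jS] := boolP (j \in S); last by rewrite wS // mul0r.
  by rewrite mulr_ge0 // subr_ge0 uS.
have /= := wu i (mem_index_enum _); rewrite mulf_eq0 subr_eq0 inE.
by have [iS|/wS->] := boolP (i \in S) => //= /orP[/eqP|->].
Qed.

Lemma hull_shift (R : numDomainType) d n (v : 'I_n -> 'rV[R]_d) (S : {set 'I_n}) y :
  hull v S y <-> hull (fun i => v i - y) S 0.
Proof.
have E w : \sum_i w i = 1 ->
    \sum_i w i *: (v i - y) = \sum_i w i *: v i - y.
  move=> w1; under eq_bigr do rewrite scalerBr.
  by rewrite sumrB -scaler_suml w1 scale1r.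
split=> -[w [w0 wS w1 wv]]; exists w; split=> //.
  by rewrite E // wv subrr.
by apply/eqP; rewrite -subr_eq0 -E // wv.
Qed.

Definition minhull (R : numDomainType) d n (v : 'I_n -> 'rV[R]_d)
    (T : {set 'I_n}) y : Prop :=
  hull v T y /\ forall T' : {set 'I_n}, T' \proper T -> ~ hull v T' y.

Lemma minhull_exists (R : numDomainType) d n (v : 'I_n -> 'rV[R]_d)
    (S : {set 'I_n}) y :
  hull v S y -> exists2 T : {set 'I_n}, T \subset S & minhull v T y.
Proof.
have [m] := ubnP #|S|; elim: m S => // m IH S Sm hS.
have [[T' [T'S hT']]|nT] := pselect (exists T' : {set 'I_n}, T' \proper S /\ hull v T' y).
  have [|T TT' mT] := IH T' _ hT'; last first.
    by exists T => //; apply: subset_trans TT' (proper_sub T'S).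
  exact: leq_trans (proper_card T'S) Sm.
by exists S => //; split=> // T' T'S hT'; apply: nT; exists T'.
Qed.

Lemma minhull_gt0 (R : numDomainType) d n (v : 'I_n -> 'rV[R]_d)
    (T : {set 'I_n}) y : minhull v T y ->
  exists w : 'I_n -> R,
    [/\ forall i, i \in T -> 0 < w i, forall i, i \notin T -> w i = 0,
        \sum_i w i = 1 & \sum_i w i *: v i = y].
Proof.
move=> [[w [w0 wT w1 wv]] mT]; exists w; split=> // i iT.
rewrite lt_def w0 andbT; apply/eqP => wi; apply: (mT (T :\ i)).
  exact: properD1.
exists w; split=> // j; rewrite !inE negb_and negbK => /orP[/eqP->|] //.
exact: wT.
Qed.

(* Moving the positive weights along a dependency until one of them vanishes. *)
Lemma minhull_indep (R : realFieldType) d n (v : 'I_n -> 'rV[R]_d)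
    (T : {set 'I_n}) (c : 'I_n -> R) t :
  minhull v T 0 -> t \in T -> c t = 0 -> (forall i, i \notin T -> c i = 0) ->
  \sum_i c i *: v i = 0 -> forall i, c i = 0.
Proof.
move=> mT tT; have [w [w0 wT _ wv]] := minhull_gt0 mT.
suff Hneg : forall c : 'I_n -> R, c t = 0 -> (forall i, i \notin T -> c i = 0) ->
    \sum_i c i *: v i = 0 -> forall i, 0 <= c i.
  move=> ct cT cv i; apply/eqP; rewrite eq_le (Hneg c) // andbT -oppr_ge0.
  apply: (Hneg (fun i => - c i)) => [|j jT|]; rewrite ?ct ?cT ?oppr0 //.
  by under eq_bigr do rewrite scaleNr; rewrite sumrN cv oppr0.
move=> {}c ct cT cv i0; rewrite leNgt; apply/negP => ci0.
case: (@arg_minP _ _ _ i0 (fun i => c i < 0) (fun i => w i / - c i) ci0).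
move=> i ci imin.
have iT : i \in T by apply: contraLR ci => /cT->; rewrite ltxx.
pose s := w i / - c i.
have s0 : 0 <= s by rewrite divr_ge0 ?oppr_ge0 ?ltW // w0.
(* The weights [w + s * c] still equal [w t > 0] at [t], so they can be normalised. *)
apply: (mT.2 (T :\ i) (properD1 iT)).
apply: (@hull_cone _ _ _ _ _ (fun j => w j + s * c j) t).
- move=> j; have [jT|jT] := boolP (j \in T); last by rewrite wT ?cT ?mulr0 ?addr0.
  have [cj|cj] := ltP (c j) 0; last by apply: addr_ge0; [apply/ltW/w0 | apply: mulr_ge0].
  by have := imin j cj; rewrite ler_pdivlMr ?oppr_gt0 // mulrN -subr_ge0 opprK.
- move=> j; rewrite !inE negb_and negbK => /orP[/eqP->|jT]; last first.
    by rewrite wT ?cT ?mulr0 ?addr0.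
  by rewrite /s invrN mulrN mulNr mulfVK ?lt_eqF // subrr.
- by rewrite ct mulr0 addr0 w0.
- under eq_bigr do rewrite scalerDl -scalerA.
  by rewrite big_split /= wv -scaler_sumr cv scaler0 addr0.
Qed.

Lemma minhull_row_free (R : realFieldType) d n m (v : 'I_n -> 'rV[R]_d)
    (T : {set 'I_n}) t (e : 'I_m -> 'I_n) :
  minhull v T 0 -> t \in T -> injective e -> (forall k, e k \in T :\ t) ->
  row_free (\matrix_k v (e k)).
Proof.
move=> mT tT inj_e eT; apply: inj_row_free => x xM.
pose c i := \sum_(k | e k == i) x 0 k.
have ck k : c (e k) = x 0 k.
  rewrite /c (bigD1 k) //= big1 ?addr0 // => j /andP[/eqP/inj_e->].
  by rewrite eqxx.
have cT i : i \notin T :\ t -> c i = 0.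
  by move=> iA; apply: big1 => k /eqP ki; rewrite -ki eT in iA.
have cv : \sum_i c i *: v i = 0.
  rewrite -[RHS]xM mulmx_sum_row.
  under eq_bigr do rewrite scaler_suml.
  rewrite (exchange_big_dep xpredT) //=; apply: eq_bigr => k _.
  by rewrite rowK (big_pred1 (e k)) // => i; rewrite /= eq_sym.
apply/rowP => k; rewrite mxE -ck; apply: (minhull_indep mT tT _ _ cv).
  by rewrite cT // !inE eqxx.
by move=> i iT; rewrite cT // !inE negb_and iT orbT.
Qed.

Lemma minhull_face (R : numDomainType) d n (v : 'I_n -> 'rV[R]_d)
    (T : {set 'I_n}) y u :
  minhull v T y -> (forall i, i \in T -> dot u y <= dot u (v i)) ->
  forall i, i \in T -> dot u (v i) = dot u y.
Proof.
move=> mT uT i; have := hull_face mT.1 uT; set F := (X in hull v X y).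
have : F \subset T by apply/subsetP => j; rewrite inE => /andP[].
rewrite subEproper => /orP[/eqP<- _|/mT.2 //].
by rewrite inE => /andP[_ /eqP].
Qed.

Lemma minhull_shift (R : numDomainType) d n (v : 'I_n -> 'rV[R]_d)
    (T : {set 'I_n}) y :
  minhull v T y -> minhull (fun i => v i - y) T 0.
Proof.
by move=> [hT mT]; split=> [|T' T'T]; rewrite -hull_shift //; apply: mT.
Qed.

(** All points of [T] but one are linearly independent, and they are orthogonal to [u]. For [u = 0]
    this is Caratheodory's bound; a nonzero [u] saves one more point. *)
Lemma minhull_card (R : realFieldType) d n (v : 'I_n -> 'rV[R]_d)
    (T : {set 'I_n}) u :
  minhull v T 0 -> (forall i, i \in T -> dot u (v i) = 0) ->
  (#|T| + (u != 0)%R <= d.+1)%N.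
Proof.
move=> mT uT; have [t tT] := hull_exists mT.1.
pose A := T :\ t; pose M : 'M_(#|A|, d) := \matrix_k v (enum_val k).
have fM : row_free M := minhull_row_free mT tT enum_val_inj (@enum_valP _ _).
have A_T (k : 'I_#|A|) : enum_val k \in T.
  by have := enum_valP k; rewrite !inE => /andP[].
have uM : (M <= kermx u^T)%MS.
  apply/sub_kermxP/matrixP => k j; rewrite !mxE.
  rewrite -[RHS](uT _ (A_T k)); apply: eq_bigr => l _.
  by rewrite !mxE ord1 mulrC.
have := mxrankS uM; rewrite mxrank_ker (eqP fM) mxrank_tr rank_rV.
rewrite (cardsD1 t T) tT -/A add1n addSn ltnS => h.
have : (\rank u <= d)%N by rewrite rank_leq_col.
by rewrite rank_rV; move: h; case: (u != 0) => h hd; lia.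
Qed.

(** Tukey depth of the origin, to which the candidate point is translated: by separation, every
    closed half-space with 0 on its boundary contains at least [k] points of [X]. *)
Definition deep (R : numDomainType) d n (v : 'I_n -> 'rV[R]_d) (k : nat)
    (X : {set 'I_n}) : Prop :=
  forall S : {set 'I_n}, S \subset X -> (#|X :\: S| < k)%N -> hull v S 0.

(** A simplex may have [d.+2] vertices but costs only [d.+1]. Let [u] separate the remaining points
    from 0: a vertex of [T] on the positive side can be kept, and if there is none, [T] lies in the
    hyperplane of [u] and has at most [d.+1] vertices. *)
Lemma deep_minhull (R : realType) d n (v : 'I_n -> 'rV[R]_d.+1) k
    (X T : {set 'I_n}) :
  deep v (k + d.+1) X -> T \subset X -> minhull v T 0 -> deep v k (X :\: T).
Proof.
move=> dX TX mT S SX Sk; apply: contrapT => /hull_sep[u un uS].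
have cT := minhull_card mT.
have [/existsP[t /andP[tT ut]]|] := boolP [exists t in T, 0 < dot u (v t)].
  apply: (@hull_pos _ _ _ v (t |: S) u); last first.
    by move=> i; rewrite !inE => /orP[/eqP->|/uS].
  apply: dX.
    rewrite subUset sub1set (subsetP TX) //=.
    exact: subset_trans SX (subsetDl _ _).
  have : X :\: (t |: S) \subset (X :\: T :\: S) :|: (T :\ t).
    apply/subsetP => i; rewrite !inE negb_or => /andP[/andP[-> ->] ->].
    by rewrite /= andbT orNb.
  move/subset_leq_card/leq_ltn_trans; apply; apply: leq_ltn_trans (leq_card_setU _ _) _.
  have := cT 0 (fun i _ => dot0l _); rewrite (cardsD1 t T) tT eqxx; lia.
rewrite negb_exists_in => /forall_inP Tu.
have T0 i : i \in T -> dot u (v i) = 0.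
  move=> iT; apply/oppr_inj; rewrite -dotNl (minhull_face mT) //.
    by rewrite dot0r oppr0.
  by move=> j jT; rewrite dot0r dotNl oppr_ge0 leNgt Tu.
apply: (@hull_pos _ _ _ v S u) => //; apply: dX.
  exact: subset_trans SX (subsetDl _ _).
have : X :\: S \subset (X :\: T :\: S) :|: T.
  by apply/subsetP => i; rewrite !inE => /andP[-> ->]; case: (i \in T).
move/subset_leq_card/leq_ltn_trans; apply; apply: leq_ltn_trans (leq_card_setU _ _) _.
by have := cT _ T0; rewrite un; lia.
Qed.

(** * A lattice point of large depth *)

(* Among the families of up-sets H j containing {f j > 0} with empty intersection,
   one of maximal total size has, for each H j different from the full type, a point z
   which lies in all the other H i and whose level is the first one outside H j; two
   such points cannot have a midpoint, so they have distinct classes. *)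
Lemma helly_midpoint (R : realDomainType) (Q J C : finType) (cl : Q -> C)
    (f : J -> Q -> R) :
  (forall x y, cl x = cl y -> exists z, forall j, f j z *+ 2 = f j x + f j y) ->
  (forall J' : {set J}, (#|J'| <= #|C|)%N ->
     exists x, forall j, j \in J' -> 0 < f j x) ->
  exists x, forall j, 0 < f j x.
Proof.
move=> mid small; apply: contrapT => none.
pose up j (A : {set Q}) := [forall x in A, forall y, (f j x <= f j y) ==> (y \in A)].
have upP j A x y : up j A -> x \in A -> f j x <= f j y -> y \in A.
  by move=> /forall_inP/(_ x) h xA xy; move: (h xA) => /forallP/(_ y)/implyP; apply.
pose P (H : {ffun J -> {set Q}}) :=
  [forall j, ([set x | 0 < f j x] \subset H j) && up j (H j)]
  && ~~ [exists x, forall j, x \in H j].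
pose H0 := [ffun j => [set x | 0 < f j x]].
have PH0 : P H0.
  apply/andP; split.
    apply/forallP => j; rewrite ffunE subxx; apply/forall_inP => x; rewrite inE => fx.
    by apply/forallP => y; apply/implyP => xy; rewrite inE (lt_le_trans fx).
  apply/negP => /existsP[x /forallP xH]; apply: none; exists x => j.
  by have := xH j; rewrite ffunE inE.
case: (@arg_maxnP _ H0 P (fun H => \sum_j #|H j|)%N PH0) => H /andP[/forallP PH nH] Hmax.
have posH j x : 0 < f j x -> x \in H j.
  by move=> fx; have /andP[/subsetP-> //] := PH j; rewrite inE.
have upH j x y : x \in H j -> f j x <= f j y -> y \in H j.
  by apply: upP; have /andP[] := PH j.
have nHx x : ~ forall j, x \in H j.
  by move=> xH; move/negP: nH; apply; apply/existsP; exists x; apply/forallP.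
pose J' := [set j | H j != finset.setT].
have crit j : exists z, j \in J' ->
    [/\ z \notin H j, forall x, x \notin H j -> f j x <= f j z
      & forall i, i != j -> z \in H i].
  have [jJ|jJ] := boolP (j \in J'); last first.
    by have [|z _] := small finset.set0; [rewrite cards0 | exists z].
  have /existsP[y0 y0H] : [exists y, y \notin H j].
    rewrite -negb_forall; apply: contraTN jJ => /forallP jH.
    by rewrite inE negbK; apply/eqP/setP => x; rewrite jH inE.
  case: (@arg_maxP _ _ _ y0 (fun y => y \notin H j) (f j) y0H) => y yH ymax.
  (* Lowering the threshold of [H j] to the level of [y], the highest point outside, enlarges it. By
     maximality the new family has a common point [z], which is outside [H j] because the old family
     has none. *)
  pose H' := [ffun i => if i == j then H j :|: [set x | f j y <= f j x] else H i].
  have : ~~ P H'.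
    apply/negP => /Hmax; apply/negP; rewrite -ltnNge.
    rewrite (bigD1 j) //= [X in (_ < X)%N](bigD1 j) //= -addSn leq_add //.
      rewrite ffunE eqxx; apply: proper_card; apply/properP; split.
        exact: subsetUl.
      by exists y; rewrite // !inE lexx orbT.
    by apply: eq_leq; apply: eq_bigr => i /negPf ij; rewrite ffunE ij.
  rewrite negb_and negbK => /orP[/negP[]|/existsP[z /forallP zH]].
    apply/forallP => i; rewrite ffunE; case: eqP => [->|_]; last exact: PH.
    have /andP[sH _] := PH j; rewrite (subset_trans sH (subsetUl _ _)) /=.
    apply/forall_inP => a; rewrite !inE => aH; apply/forallP => b; apply/implyP => ab.
    rewrite !inE; case/orP: aH => [aH|ya]; first by rewrite (upH _ _ _ aH ab).
    by rewrite (le_trans ya ab) orbT.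
  have zHi i : i != j -> z \in H i by move=> /negPf ij; have := zH i; rewrite ffunE ij.
  have zHj : z \notin H j.
    apply/negP => zj; apply: (nHx z) => i.
    by have [->|/zHi] := eqVneq i j.
  exists z => _; split=> // x xH; apply: le_trans (ymax x xH) _.
  by have := zH j; rewrite ffunE eqxx !inE (negPf zHj).
have [z zP] := boolp.choice crit.
have [J'C|J'C] := leqP #|J'| #|C|.
  have [x xJ] := small J' J'C; apply: (nHx x) => j.
  have [jJ|] := boolP (j \in J'); first by apply/posH/xJ.
  by rewrite inE negbK => /eqP->; rewrite inE.
have /dinjectivePn[i iJ [j /andP[/= ji jJ] zij]] : ~~ dinjectiveb (cl \o z) (mem J').
  apply: contraL J'C => /dinjectiveP inj; rewrite -leqNgt -(card_in_imset inj).
  exact: max_card.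
have [m mP] := mid _ _ zij.
have [ziH zimax zi] := zP i iJ; have [zjH zjmax zj] := zP j jJ.
(* If the midpoint [c] were outside [H k], its level would be at most that of [a], hence at least
   that of [b], which would put it inside. *)
have in_H k a b c : f k c *+ 2 = f k a + f k b -> a \notin H k ->
    (forall x, x \notin H k -> f k x <= f k a) -> b \in H k -> c \in H k.
  move=> fc aH amax bH; apply: contraNT aH => /amax ca; apply: (upH _ b) => //.
  by lra.
apply: (nHx m) => k; have fm := mP k.
have [ki|ki] := eqVneq k i.
  apply: (in_H k (z i) (z j)) => //; rewrite ki ?zj //; by rewrite eq_sym.
have [kj|kj] := eqVneq k j.
  by apply: (in_H k (z j) (z i)) => //; rewrite 1?addrC ?kj ?zi.
have [ij|/ltW ij] := leP (f k (z i)) (f k (z j)).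
  by apply: (upH _ (z i)); [exact: zi | lra].
by apply: (upH _ (z j)); [exact: zj | lra].
Qed.

Lemma lat_midpoint (R : realType) d (u : 'rV[R]_d) (p : 'rV[R]_d)
    (a b c : 'rV[int]_d) : c *+ 2 = a + b ->
  dot u (lat R c - p) *+ 2 = dot u (lat R a - p) + dot u (lat R b - p).
Proof.
move=> cab; have lcab : lat R c *+ 2 = lat R a + lat R b.
  by apply/matrixP => i j; have := congr1 (fun M : 'rV[int]_d => M i j) cab;
    rewrite !mulr2n !mxE => cab'; rewrite -!rmorphD cab'.
have : dot u (lat R c) + dot u (lat R c) = dot u (lat R a) + dot u (lat R b).
  by rewrite -!dotDr -lcab mulr2n.
by rewrite !dotBr; lra.
Qed.

(** Otherwise each lattice point [q] of a box around the family lies on the boundary of an open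
    half-space missing at most [k] members. Any [2 ^ d.+1] of these half-spaces miss fewer than [n]
    members, so they share one. By [helly_midpoint] with parity classes all of them share a lattice
    point [z], yet the half-space of [z] excludes [z]. *)
Lemma centerpoint (R : realType) d n k (x : 'I_n -> 'rV[int]_d.+1) :
  (2 ^ d.+1 * k < n)%N ->
  exists p, deep (fun i => lat R (x i) - lat R p) k.+1 finset.setT.
Proof.
move=> kn; apply: contrapT => none.
pose M := (\sum_i \sum_j absz (x i 0%R j))%N.
have xM i j : (absz (x i 0%R j) <= M)%N.
  rewrite /M (bigD1 i) //= (bigD1 j) //= -addnA leq_addr //.
(* A finite box, recentred by [M], that contains the family and all integral midpoints of its own
   points. *)
pose Q : finType := {ffun 'I_d.+1 -> 'I_(2 * M).+1}.
pose pt (q : Q) : 'rV[int]_d.+1 := \row_j ((q j)%:Z - M%:Z).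
pose cl (q : Q) := [ffun j => odd (q j)].
have bad (q : Q) : exists Su : {set 'I_n} * 'rV[R]_d.+1, (#|~: Su.1| <= k)%N /\
    forall i, i \in Su.1 -> 0 < dot Su.2 (lat R (x i) - lat R (pt q)).
  apply: contrapT => nbad; apply: none; exists (pt q) => S _ Sk.
  apply: contrapT => /hull_sep[u _ uS]; apply: nbad; exists (S, u).
  by rewrite -setTD.
have [Su SuP] := boolp.choice bad.
pose f (q z : Q) := dot (Su q).2 (lat R (pt z) - lat R (pt q)).
have [|J' J'C|z zP] := @helly_midpoint R Q Q _ cl f.
- move=> a b ab.
  have half j : ((a j + b j)./2 < (2 * M).+1)%N.
    have := ltn_ord (a j); have := ltn_ord (b j); lia.
  exists [ffun j => Ordinal (half j)] => q; apply: lat_midpoint.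
  apply/rowP => j; rewrite mulr2n !mxE ffunE /=.
  have := congr1 (fun g : {ffun _ -> bool} => g j) ab; rewrite !ffunE => odd_ab.
  have := odd_double_half (a j + b j); rewrite oddD odd_ab addbb -addnn.
  move: ((a j + b j)./2)%N => h; rewrite add0n => hab.
  by rewrite addrACA -PoszD hab PoszD addrACA.
- have [i iP] : exists i, forall q, q \in J' -> i \in (Su q).1.
    apply: contrapT => ni.
    have cov : finset.setT \subset \bigcup_(q in J') ~: (Su q).1.
      apply/subsetP => i _; apply: contrapT => iU; apply: ni; exists i => q qJ.
      apply: contrapT => /negP iS; apply: iU; apply/bigcupP; exists q => //.
      by rewrite inE.
    have := subset_leq_card cov; rewrite cardsT card_ord leqNgt => /negP; apply.
    apply: leq_ltn_trans kn.
    apply: (@leq_trans (\sum_(q in J') k)%N).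
      apply: leq_trans (_ : \sum_(q in J') #|~: (Su q).1| <= _)%N; last first.
        by apply: leq_sum => q _; have [] := SuP q.
      elim/big_rec2: _ => [|q m A _ Am]; first by rewrite cards0.
      by apply: leq_trans (leq_card_setU _ _) _; rewrite leq_add2l.
    rewrite sum_nat_const leq_mul2r; apply/orP; right.
    by apply: leq_trans J'C _; rewrite card_ffun card_bool card_ord.
  have xz j : (absz (x i 0%R j + M%:Z)%R < (2 * M).+1)%N by have := xM i j; lia.
  exists [ffun j => Ordinal (xz j)] => q qJ; rewrite /f.
  rewrite (_ : pt _ = x i); first by have [_] := SuP q; apply; apply: iP.
  by apply/rowP => j; rewrite mxE ffunE /=; have := xM i j; lia.
- by have := zP z; rewrite /f subrr dot0r ltxx.
Qed.

(** * Eight points in space *)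

(** Weights are sums of indicators, so the four indices may coincide. *)
Lemma hull_comb4 (R : numFieldType) d n (v : 'I_n -> 'rV[R]_d) (S : {set 'I_n})
    i1 i2 i3 i4 c1 c2 c3 c4 :
  [&& i1 \in S, i2 \in S, i3 \in S & i4 \in S] ->
  [&& 0 < c1, 0 <= c2, 0 <= c3 & 0 <= c4] ->
  (forall k, c1 * v i1 0 k + c2 * v i2 0 k + c3 * v i3 0 k + c4 * v i4 0 k = 0) ->
  hull v S 0.
Proof.
case/and4P=> S1 S2 S3 S4 /and4P[c1p c2p c3p c4p] cv.
pose w i := c1 * (i == i1)%:R + c2 * (i == i2)%:R + c3 * (i == i3)%:R
            + c4 * (i == i4)%:R.
have ge0 c (b : bool) : 0 <= c -> 0 <= c * b%:R by move=> c0; rewrite mulr_ge0 // ler0n.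
have sum1 c j : \sum_i (c * (i == j)%:R) *: v i = c *: v j.
  rewrite (bigD1 j) //= eqxx mulr1 big1 ?addr0 // => i /negPf->.
  by rewrite mulr0 scale0r.
apply: (@hull_cone _ _ _ _ _ w i1).
- by move=> i; rewrite !addr_ge0 ?ge0 // ltW.
- move=> i iS; have neq j : j \in S -> (i == j) = false.
    by move=> jS; apply/negbTE; apply: contraNneq iS => ->.
  by rewrite /w !neq // !mulr0 !addr0.
- by rewrite /w eqxx mulr1 -!addrA ltr_wpDr // !addr_ge0 ?ge0.
- rewrite /w; under eq_bigr do rewrite !scalerDl.
  rewrite !big_split /= !sum1; apply/rowP => k.
  by rewrite !mxE -[RHS](cv k).
Qed.

Lemma ord3_cases (i j l k : 'I_3) : uniq [:: i; j; l] -> [\/ k = i, k = j | k = l].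
Proof.
move=> u; have : k \in [:: i; j; l].
  rewrite (_ : [:: i; j; l] =i 'I_3) //; apply/subset_cardP => //.
  - by rewrite (card_uniqP u) card_ord.
  - exact/subsetP.
rewrite !inE => /or3P[] /eqP->; [exact: Or31|exact: Or32|exact: Or33].
Qed.

(* Coordinates with respect to three points e k; the point a is negative in all
   coordinates, and b k only in the coordinate k. *)
Definition octet (R : numDomainType) n (g : 'I_n -> 'rV[R]_3)
    (e b : 'I_3 -> 'I_n) : Prop :=
  [/\ forall k l, g (e k) 0 l = (l == k)%:R,
      forall k, g (b k) 0 k < 0,
      forall k l, k != l -> 0 <= g (b k) 0 l
    & forall k l, k != l ->
        g (b k) 0 l * g (b l) 0 k <= g (b k) 0 k * g (b l) 0 l].

(** For negative [a]: once a multiple of [a] has cancelled coordinate [l] of [b i], coordinate [j]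
    is nonpositive. Exchanging [j] and [l] reverses the inequality. *)
Definition octet_side (R : numDomainType) n (g : 'I_n -> 'rV[R]_3)
    (b : 'I_3 -> 'I_n) a i j l : bool :=
  g (b i) 0 l * g a 0 j <= g (b i) 0 j * g a 0 l.

(** Adding a multiple of [a] to [b i] cancels coordinate [l] and leaves the other two nonpositive;
    [e i] and [e j] compensate. *)
Lemma octet_hull1 (R : realFieldType) n (g : 'I_n -> 'rV[R]_3) e b a i j l :
  octet g e b -> (forall k, g a 0 k < 0) -> uniq [:: i; j; l] ->
  octet_side g b a i j l -> hull g [set b i; a; e i; e j] 0.
Proof.
move=> [ge gb gb' _] ga ijl; rewrite /octet_side => side.
move: (ijl); rewrite /= !inE negb_or => /and3P[/andP[ij il] jl _].
apply: (@hull_comb4 _ _ _ _ _ (b i) a (e i) (e j) (- g a 0 l) (g (b i) 0 l)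
  (g (b i) 0 i * g a 0 l - g (b i) 0 l * g a 0 i)
  (g (b i) 0 j * g a 0 l - g (b i) 0 l * g a 0 j)).
- by rewrite !inE !eqxx !orbT.
- rewrite oppr_gt0 ga gb' //= !subr_ge0 side andbT.
  apply: (@le_trans _ _ 0); first by rewrite nmulr_lle0 ?gb'.
  by rewrite ltW // nmulr_lgt0 ?gb.
- move=> k; have [->|->|->] := ord3_cases k ijl; rewrite !ge ?eqxx.
  + by rewrite (negPf ij) mulr1 mulr0; ring.
  + by rewrite eq_sym (negPf ij) mulr1 mulr0; ring.
  + by rewrite eq_sym (negPf il) eq_sym (negPf jl) !mulr0; ring.
Qed.

(** The minors [x], [y], [z] cancel coordinates [j] and [l] of [b i], [a], [b l]. By the last clause
    of [octet], the rest in coordinate [i] is nonpositive, and [e i] compensates. *)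
Lemma octet_hull2 (R : realFieldType) n (g : 'I_n -> 'rV[R]_3) e b a i j l :
  octet g e b -> (forall k, g a 0 k < 0) -> uniq [:: i; j; l] ->
  octet_side g b a i j l -> hull g [set b i; a; b l; e i] 0.
Proof.
move=> [ge gb gb' gbb] ga ijl side.
move: (ijl); rewrite /= !inE negb_or => /and3P[/andP[ij il] jl _].
pose x := g a 0 j * g (b l) 0 l - g (b l) 0 j * g a 0 l.
pose y := g (b l) 0 j * g (b i) 0 l - g (b i) 0 j * g (b l) 0 l.
pose z := g (b i) 0 j * g a 0 l - g (b i) 0 l * g a 0 j.
have li : l != i by rewrite eq_sym.
have lj : l != j by rewrite eq_sym.
have x0 : 0 < x.
  rewrite subr_gt0; apply: (@le_lt_trans _ _ 0); last by rewrite nmulr_lgt0 ?gb.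
  by rewrite nmulr_lle0 ?gb'.
have y0 : 0 <= y.
  rewrite subr_ge0; apply: (@le_trans _ _ 0); last by rewrite mulr_ge0 ?gb'.
  by rewrite nmulr_lle0 ?gb'.
have z0 : 0 <= z by rewrite subr_ge0.
apply: (@hull_comb4 _ _ _ _ _ (b i) a (b l) (e i) x y z
  (- (x * g (b i) 0 i + y * g a 0 i + z * g (b l) 0 i))).
- by rewrite !inE !eqxx !orbT.
- rewrite x0 y0 z0 /=; have bb := gbb _ _ il.
  have -> : - (x * g (b i) 0 i + y * g a 0 i + z * g (b l) 0 i) =
     - g a 0 j * (g (b i) 0 i * g (b l) 0 l - g (b i) 0 l * g (b l) 0 i)
     + g (b l) 0 j * (g (b i) 0 i * g a 0 l) + y * - g a 0 i
     + g (b l) 0 i * g (b i) 0 j * - g a 0 l by rewrite /x /z; ring.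
  have ga0 k : 0 <= - g a 0 k by rewrite oppr_ge0 ltW.
  have sa : 0 <= g (b i) 0 i * g a 0 l by rewrite ltW // nmulr_lgt0.
  apply: addr_ge0; last by rewrite !mulr_ge0 ?gb'.
  apply: addr_ge0; last by rewrite mulr_ge0.
  apply: addr_ge0; last by rewrite mulr_ge0 ?gb'.
  by rewrite mulr_ge0 // subr_ge0.
- move=> k; have [->|->|->] := ord3_cases k ijl; rewrite !ge ?eqxx.
  + by rewrite mulr1; ring.
  + by rewrite eq_sym (negPf ij) mulr0 /x /y /z; ring.
  + by rewrite eq_sym (negPf il) mulr0 /x /y /z; ring.
Qed.

(** The two simplices are [b i], [a], [e i], [e j] and the complementary [b l], [a'], [b j], [e l].
    Sign patterns show that they are disjoint. *)
Lemma octet_split (R : realFieldType) n (g : 'I_n -> 'rV[R]_3) e b a a' i j l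
    (E : {set 'I_n}) :
  octet g e b -> (forall k, g a 0 k < 0) -> (forall k, g a' 0 k < 0) -> a != a' ->
  (forall k, e k \in E) -> (forall k, b k \in E) -> a \in E -> a' \in E ->
  uniq [:: i; j; l] -> octet_side g b a i j l -> octet_side g b a' l i j ->
  exists A : {set 'I_n}, [/\ A \subset E, hull g A 0 & hull g (E :\: A) 0].
Proof.
move=> oct ga ga' aa' eE bE aE a'E ijl s1 s2.
have [ge gb gb' _] := oct.
have lij : uniq [:: l; i; j].
  move: ijl; rewrite /= !inE !negb_or (eq_sym l i) (eq_sym l j).
  by case/and3P=> /andP[-> ->] ->.
exists [set b i; a; e i; e j]; split.
- by rewrite !subUset !sub1set bE aE !eE.
- exact: octet_hull1 ijl s1.
apply: hullS (octet_hull2 oct ga' lij s2).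
move: (ijl); rewrite /= !inE negb_or => /and3P[/andP[ij il] jl _].
have be k m : (b k == e m) = false.
  apply/eqP => bem; have := gb k; rewrite bem ge.
  by apply/negP; rewrite -leNgt ler0n.
have ae a1 m : (forall k, g a1 0 k < 0) -> (a1 == e m) = false.
  move=> ga1; apply/eqP => bem; have := ga1 m; rewrite bem ge.
  by apply/negP; rewrite -leNgt ler0n.
have ab a1 m : (forall k, g a1 0 k < 0) -> (a1 == b m) = false.
  move=> ga1; apply/eqP => abm; have [p mp] : exists p, m != p.
    by have [->|mi] := eqVneq m i; [exists j | exists i].
  by have := ga1 p; rewrite abm ltNge gb'.
have bb k m : k != m -> (b k == b m) = false.
  by move=> km; apply/eqP => bkm; have := gb k; rewrite bkm ltNge gb' // eq_sym.
have ee k m : k != m -> (e k == e m) = false.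
  move=> km; apply/eqP => ekm; have := ge k m; rewrite ekm ge eqxx eq_sym (negPf km).
  by move/eqP; rewrite oner_eq0.
have li : l != i by rewrite eq_sym.
have lj : l != j by rewrite eq_sym.
have ji : j != i by rewrite eq_sym.
have inD x : x \in E -> (x == b i) = false -> (x == a) = false ->
    (x == e i) = false -> (x == e j) = false ->
    x \in E :\: [set b i; a; e i; e j].
  by rewrite !inE => -> -> -> -> ->.
rewrite !subUset !sub1set !inD // ?be ?bb ?ee ?(ab a') ?(ae a') //.
all: by rewrite eq_sym ?be ?(ab a) ?(ae a) ?(negPf aa').
Qed.

(** In the product of the three inequalities, taken with [- c] for [c], the factors from [c1], [c2],
    [c3] cancel. *)
Lemma ceva_lt (R : realFieldType) (x1 x2 x3 y1 y2 y3 c1 c2 c3 : R) :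
  0 <= x1 -> 0 <= x2 -> 0 <= x3 -> c1 < 0 -> c2 < 0 -> c3 < 0 ->
  y1 * c3 < x1 * c2 -> y2 * c1 < x2 * c3 -> y3 * c2 < x3 * c1 ->
  x1 * x2 * x3 < y1 * y2 * y3.
Proof.
move=> x10 x20 x30; rewrite -(oppr_gt0 c1) -(oppr_gt0 c2) -(oppr_gt0 c3).
move=> c10 c20 c30 h1 h2 h3.
have h1' : x1 * - c2 < y1 * - c3 by lra.
have h2' : x2 * - c3 < y2 * - c1 by lra.
have h3' : x3 * - c1 < y3 * - c2 by lra.
have x1c : 0 <= x1 * - c2 by rewrite mulr_ge0 // ltW.
have x2c : 0 <= x2 * - c3 by rewrite mulr_ge0 // ltW.
have x3c : 0 <= x3 * - c1 by rewrite mulr_ge0 // ltW.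
have := ltr_pM (mulr_ge0 x1c x2c) x3c (ltr_pM x1c x2c h1' h2') h3'.
rewrite [ltLHS](_ : _ = x1 * x2 * x3 * (- c1 * - c2 * - c3)); last by ring.
rewrite [ltRHS](_ : _ = y1 * y2 * y3 * (- c1 * - c2 * - c3)); last by ring.
by rewrite ltr_pM2r // !mulr_gt0.
Qed.

(* If no order of the coordinates allows the split, then a and a' are strictly on
   opposite sides for every i, which is impossible as in Ceva's theorem: the product
   over i of the comparisons for a contradicts that for a'. *)
Lemma octet_radon (R : realFieldType) n (g : 'I_n -> 'rV[R]_3) e b a a'
    (E : {set 'I_n}) :
  octet g e b -> (forall k, g a 0 k < 0) -> (forall k, g a' 0 k < 0) -> a != a' ->
  (forall k, e k \in E) -> (forall k, b k \in E) -> a \in E -> a' \in E ->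
  exists A : {set 'I_n}, [/\ A \subset E, hull g A 0 & hull g (E :\: A) 0].
Proof.
move=> oct ga ga' aa' eE bE aE a'E; apply: contrapT => no.
have [_ _ gb' _] := oct.
have nw x y : (x = a /\ y = a') \/ (x = a' /\ y = a) -> forall i j l,
    uniq [:: i; j; l] -> octet_side g b x i j l -> ~~ octet_side g b y l i j.
  move=> xy i j l u s1; apply/negP => s2; apply: no.
  by case: xy s1 s2 => -[-> ->] s1 s2;
    apply: (octet_split oct _ _ _ eE bE _ _ u s1 s2) => //; rewrite eq_sym.
have total a1 i j l : octet_side g b a1 i j l || octet_side g b a1 i l j.
  exact: le_total.
pose i0 : 'I_3 := inord 0; pose i1 : 'I_3 := inord 1; pose i2 : 'I_3 := inord 2.
have u012 : uniq [:: i0; i1; i2] by rewrite /= !inE -!val_eqE /= !inordK.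
have ceva a1 a2 : (forall k, g a1 0 k < 0) -> (forall k, g a2 0 k < 0) ->
  ~~ octet_side g b a1 i0 i1 i2 -> ~~ octet_side g b a1 i1 i2 i0 ->
  ~~ octet_side g b a1 i2 i0 i1 -> ~~ octet_side g b a2 i0 i2 i1 ->
  ~~ octet_side g b a2 i1 i0 i2 -> ~~ octet_side g b a2 i2 i1 i0 -> False.
  move=> ga1 ga2; rewrite /octet_side -!ltNge => h1 h2 h3 k1 k2 k3.
  have := ceva_lt _ _ _ (ga1 i0) (ga1 i1) (ga1 i2) h1 h2 h3.
  have := ceva_lt _ _ _ (ga2 i0) (ga2 i2) (ga2 i1) k1 k3 k2.
  rewrite !gb' //; try by rewrite -val_eqE /= !inordK.
  move=> /(_ isT isT isT) k /(_ isT isT isT) h; lra.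
(* Alternating between [x] and [y] carries a comparison over to the cyclically shifted triple; three
   shifts yield the six strict inequalities for [ceva]. *)
have orient x y : (x = a /\ y = a') \/ (x = a' /\ y = a) -> forall i j l,
    uniq [:: i; j; l] -> octet_side g b x i j l ->
    [/\ ~~ octet_side g b x i l j, ~~ octet_side g b y l i j
      & octet_side g b x l i j].
  move=> xy i j l u xijl.
  have yx : (y = a /\ x = a') \/ (y = a' /\ x = a) by case: xy => -[-> ->]; [right|left].
  have ulij : uniq [:: l; i; j] by rewrite -(rot_uniq 1).
  have ujli : uniq [:: j; l; i] by rewrite -(rot_uniq 2).
  have ulji : uniq [:: l; j; i] by rewrite -rev_uniq.
  have ujil : uniq [:: j; i; l] by rewrite -(rot_uniq 1) -rev_uniq.
  have ylij := nw _ _ xy _ _ _ u xijl.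
  have ylji : octet_side g b y l j i by have := total y l i j; rewrite (negPf ylij).
  have yjli : ~~ octet_side g b y j l i.
    by apply: contraL xijl => /(nw _ _ yx _ _ _ ujli).
  have yjil : octet_side g b y j i l by have := total y j l i; rewrite (negPf yjli).
  have xilj := nw _ _ yx _ _ _ ulji ylji.
  have xlji := nw _ _ yx _ _ _ ujil yjil.
  by split=> //; have := total x l i j; rewrite (negPf xlji) orbF.
have u201 : uniq [:: i2; i0; i1] by rewrite -(rot_uniq 1).
have u120 : uniq [:: i1; i2; i0] by rewrite -(rot_uniq 2).
have u021 : uniq [:: i0; i2; i1] by rewrite -(rot_uniq 1) -rev_uniq.
have u102 : uniq [:: i1; i0; i2] by rewrite -(rot_uniq 2) -rev_uniq.
have u210 : uniq [:: i2; i1; i0] by rewrite -rev_uniq.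
have ori := orient _ _ (or_introl (conj (erefl a) (erefl a'))).
case/orP: (total a i0 i1 i2) => s0.
- have [p0 q0 s2] := ori _ _ _ u012 s0; have [p2 q2 s1] := ori _ _ _ u201 s2.
  by have [p1 q1 _] := ori _ _ _ u120 s1; apply: (ceva a' a).
- have [p0 q0 s1] := ori _ _ _ u021 s0; have [p1 q1 s2] := ori _ _ _ u102 s1.
  by have [p2 q2 _] := ori _ _ _ u210 s2; apply: (ceva a a').
Qed.

Lemma hull_ge (R : numDomainType) d n (v : 'I_n -> 'rV[R]_d) (S : {set 'I_n}) y u c :
  hull v S y -> (forall i, i \in S -> c <= dot u (v i)) -> c <= dot u y.
Proof.
move=> [w [w0 wS w1 <-]] uS; rewrite dot_sumr -[c]mul1r -w1 mulr_suml.
apply: ler_sum => i _; have [iS|/wS->] := boolP (i \in S); last by rewrite !mul0r.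
by rewrite ler_wpM2l // uS.
Qed.

Lemma hull_mulmx (R : numDomainType) d n (v : 'I_n -> 'rV[R]_d) (S : {set 'I_n})
    (E : 'M_d) : hull v S 0 -> hull (fun i => v i *m E) S 0.
Proof.
move=> [w [w0 wS w1 wv]]; exists w; split=> //.
have := congr1 (mulmxr E) wv; rewrite /= mul0mx mulmx_suml => wE; rewrite -[RHS]wE.
by apply: eq_bigr => i _; rewrite scalemxAl.
Qed.

Lemma dot_delta (R : pzRingType) d (k : 'I_d) (x : 'rV[R]_d) :
  dot (delta_mx 0 k) x = x 0 k.
Proof.
rewrite /dot (bigD1 k) //= mxE !eqxx mul1r big1 ?addr0 // => j /negPf jk.
by rewrite mxE jk andbF mul0r.
Qed.

Lemma minhull_coord_lt0 (R : realFieldType) n (g : 'I_n -> 'rV[R]_3)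
    (T : {set 'I_n}) (e : 'I_3 -> 'I_n) a :
  minhull g T 0 -> a \in T -> injective e -> (forall k, e k \in T :\ a) ->
  (forall t, t \in T -> t = a \/ exists k, t = e k) ->
  (forall k l, g (e k) 0 l = (l == k)%:R) -> forall k, g a 0 k < 0.
Proof.
move=> mT aT inj_e eT Te ge k; have [w [w0 wT _ wg]] := minhull_gt0 mT.
have ekT : e k \in T by have := eT k; rewrite inE => /andP[].
have ea j : e j != a by have := eT j; rewrite !inE => /andP[].
have := congr1 (fun x : 'rV[R]_3 => x 0 k) wg; rewrite summxE !mxE.
rewrite (bigD1 a) //= (bigD1 (e k)) //= [X in _ + (_ + X)]big1.
  rewrite !mxE ge eqxx mulr1 addr0 => /eqP; rewrite addr_eq0 => /eqP wa.
  by rewrite -(pmulr_rlt0 _ (w0 a aT)) wa oppr_lt0 w0.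
move=> i /andP[ia iek]; rewrite mxE.
have [/Te[/eqP|[j ij]]|/wT->] := boolP (i \in T); last by rewrite mul0r.
  by rewrite (negPf ia).
move: iek; rewrite ij (inj_eq inj_e) ge eq_sym => /negPf->.
by rewrite mulr0.
Qed.

(** A ratio test: adding [r j] times [a] to the point [i], with [r j] maximal, cancels coordinate
    [j] and makes the others nonpositive, so [i] can replace [e j]. Coordinate [k] ensures
    [0 <= r j]. *)
Lemma octet_exchange (R : realFieldType) n (g : 'I_n -> 'rV[R]_3)
    (e : 'I_3 -> 'I_n) a i k :
  (forall k l, g (e k) 0 l = (l == k)%:R) -> (forall k, g a 0 k < 0) ->
  0 <= g i 0 k ->
  exists j p q, uniq [:: j; p; q] /\ hull g [set i; a; e p; e q] 0.
Proof.
move=> ge ga gik; pose r l := g i 0 l / - g a 0 l.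
case: (@arg_maxP _ _ _ k xpredT r isT) => j _ jmax.
have ga' l : 0 < - g a 0 l by rewrite oppr_gt0.
have rj0 : 0 <= r j by apply: le_trans (jmax k isT); rewrite divr_ge0 // ltW.
have rj l : 0 <= - (g i 0 l + r j * g a 0 l).
  have : r l <= r j := jmax l isT.
  by rewrite [r l]/r ler_pdivrMr // oppr_ge0; lra.
have [p [q u]] : exists p q, uniq [:: j; p; q].
  exists (j + 1), (j + 1 + 1).
  by case: j {jmax rj0 rj} => [[|[|[|]]]].
move: (u); rewrite /= !inE negb_or => /and3P[/andP[jp jq] pq _].
exists j, p, q; split=> //.
apply: (@hull_comb4 _ _ _ _ _ i a (e p) (e q) 1 (r j)
   (- (g i 0 p + r j * g a 0 p)) (- (g i 0 q + r j * g a 0 q))).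
- by rewrite !inE !eqxx !orbT.
- by rewrite ltr01 rj0 !rj.
- move=> l; have [->|->|->] := ord3_cases l u; rewrite !ge ?eqxx.
  + rewrite (negPf jp) (negPf jq) /r invrN mulrN mulNr mulfVK ?lt_eqF //.
    by rewrite !mulr0 !addr0 mul1r subrr.
  + by rewrite (negPf pq) mulr0 mulr1; ring.
  + by rewrite eq_sym (negPf pq) mulr0 mulr1; ring.
Qed.

(** Let [T] be minimal with at most three points and [u] positive on [X :\: T]. Keeping a single [t]
    of [T] preserves 0 in the hull, so [dot u] is nonpositive on [T], hence zero there. The face
    [dot u = 0] then reduces to [t], so [T] is that singleton, and removing it contradicts the
    depth. *)
Lemma nosplit_card (R : realType) n (v : 'I_n -> 'rV[R]_3) (X T : {set 'I_n}) :
  deep v 3 X ->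
  (forall A : {set 'I_n}, A \subset X -> hull v A 0 -> ~ hull v (X :\: A) 0) ->
  T \subset X -> hull v T 0 -> (3 < #|T|)%N.
Proof.
move=> dX no TX hT; have [T' T'T mT] := minhull_exists hT.
apply: leq_trans (subset_leq_card T'T); have {T TX hT T'T} T'X := subset_trans T'T TX.
move: T' T'X mT => T TX mT; rewrite ltnNge; apply/negP => T3.
have [u un uX] := hull_sep (no T TX mT.1).
have hA (A : {set 'I_n}) : A \subset T -> (#|T :\: A| < 3)%N ->
    hull v ((X :\: T) :|: A) 0.
  move=> AT cA; apply: dX; first by rewrite subUset subsetDl (subset_trans AT).
  apply: leq_ltn_trans cA; apply: subset_leq_card; apply/subsetP => i.
  by rewrite !inE; case: (i \in X); case: (i \in T); case: (i \in A).
have uS (A : {set 'I_n}) : A \subset T -> (#|T :\: A| < 3)%N ->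
    exists2 i, i \in A & dot u (v i) <= 0.
  move=> AT cA; apply: contrapT => nA; apply: (hull_pos (u := u) (hA A AT cA)) => i.
  rewrite inE => /orP[/uX //|iA]; rewrite ltNge; apply/negP => ui.
  by apply: nA; exists i.
have cD1 t : t \in T -> (#|T :\: [set t]| < 3)%N.
  by move=> tT; move: T3; rewrite (cardsD1 t T) tT.
have uT0 i : i \in T -> dot u (v i) = 0.
  move=> iT; apply/oppr_inj; rewrite -dotNl (minhull_face mT) //.
    by rewrite dot0r oppr0.
  move=> t tT; rewrite dot0r dotNl oppr_ge0.
  have [|_ /set1P-> //] := uS [set t] _ (cD1 t tT).
  by rewrite sub1set.
have [t tT] := hull_exists mT.1.
have tT' : [set t] \subset T by rewrite sub1set.
have hF : hull v [set t] 0.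
  have := hull_face (u := u) (hA _ tT' (cD1 t tT)).
  rewrite dot0r => hF; apply: hullS (hF _).
    apply/subsetP => i; rewrite inE => /andP[/setUP[/uX ui|//]].
    by rewrite gt_eqF.
  by move=> i /setUP[/uX/ltW //|/set1P->]; rewrite uT0.
have [Tt|] := eqVneq [set t] T; last first.
  by move=> tnT; apply: (mT.2 [set t]) => //; rewrite properEneq tnT.
have [|i] := uS finset.set0 (sub0set _); last by rewrite inE.
by rewrite setD0 -Tt cards1.
Qed.

(** * The nearest remaining hull *)

(** Each coordinate is negative at no more than [#|B| - 2 <= 1] points, and each point has a
    negative coordinate. This matches the points of [B] bijectively with the three coordinates. *)
Lemma octet_points (R : realFieldType) n (g : 'I_n -> 'rV[R]_3) (B : {set 'I_n}) i0 :
  i0 \in B -> (#|B| <= 3)%N -> (forall i, i \in B -> exists k, g i 0 k < 0) ->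
  (forall k, (1 < #|[set i in B | (0 <= g i 0 k)%R]|)%N) ->
  exists b : 'I_3 -> 'I_n,
    [/\ forall k, b k \in B, forall k, g (b k) 0 k < 0,
        forall k l, k != l -> 0 <= g (b k) 0 l
      & forall i, i \in B -> exists k, i = b k].
Proof.
move=> i0B B3 negB nneg2.
pose neg k := [set i in B | g i 0 k < 0].
have cneg k : (#|neg k| + 1 < #|B|)%N.
  pose N : {set 'I_n} := [set i in B | 0 <= g i 0 k]; have : (1 < #|N|)%N := nneg2 k.
  rewrite (_ : neg k = B :\: N); last first.
    apply/setP => i; rewrite !inE ltNge.
    by case: (i \in B); rewrite ?andbT ?andbF.
  have := cardsID N B; rewrite (setIidPr _); last first.
    by apply/subsetP => i; rewrite inE => /andP[].
  lia.
have kapP i : exists k, i \in B -> i \in neg k.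
  have [iB|] := boolP (i \in B); last by exists 0.
  by have [k gik] := negB i iB; exists k => _; rewrite inE iB.
have [kap {}kapP] := boolp.choice kapP.
have neg1 k i j : i \in neg k -> j \in neg k -> i = j.
  have : (#|neg k| <= 1)%N by have := cneg k; lia.
  by move/card_le1P => h ik jk; have := h i ik j; rewrite jk inE => /esym/eqP.
have kap_inj : {in B &, injective kap}.
  move=> i j iB jB kij; apply: (neg1 (kap i)); first exact: kapP.
  by rewrite kij; apply: kapP.
have B_3 : #|B| = 3%N.
  have ik := kapP i0 i0B; have := cneg (kap i0).
  by rewrite (cardsD1 i0 (neg _)) ik; lia.
have surj k : exists i, i \in B /\ kap i = k.
  have : k \in kap @: B.
    rewrite (_ : kap @: B = finset.setT) ?inE //; apply/eqP.
    by rewrite eqEcard subsetT cardsT card_ord card_in_imset // B_3.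
  by move/imsetP => [i iB ->]; exists i.
have [b bP] := boolp.choice surj.
have bB k : b k \in B by have [] := bP k.
have kb k : kap (b k) = k by have [] := bP k.
exists b; split=> // [k|k l kl|i iB].
- by have := kapP _ (bB k); rewrite kb inE => /andP[].
- rewrite leNgt; apply/negP => gkl; move/eqP: kl; apply.
  rewrite -(kb k) -(kb l); congr kap; apply: (neg1 l).
    by rewrite inE bB.
  by have := kapP _ (bB l); rewrite kb.
- by exists (kap i); apply: kap_inj; rewrite ?kb.
Qed.

(* [V k l] is the coordinate [l] of [b k], and [h l] the product of [e l] with a
   vector whose product with every [b k] is positive. *)
Lemma octet_cross (R : realFieldType) (V : 'I_3 -> 'I_3 -> R) (h : 'I_3 -> R) :
  (forall k, h k <= 0) -> (forall k l, k != l -> 0 <= V k l) ->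
  (forall k, V k k < 0) -> (forall k, 0 < \sum_l V k l * h l) ->
  forall i l, i != l -> V i l * V l i <= V i i * V l l.
Proof.
move=> h0 V0 Vn Vh.
have key i l : i != l -> - (V i l * h l) < V i i * h i.
  move=> il; have := Vh i; rewrite (bigD1 i) //= (bigD1 l) 1?eq_sym //=.
  set s := \sum_(k | _) _.
  have : s <= 0.
    by apply: sumr_le0 => k /andP[ki _]; rewrite mulr_ge0_le0 // V0 // eq_sym.
  lra.
(* The claim is the product of [key] for [(i, l)] and for [(l, i)], divided by [h i * h l > 0]. *)
move=> i l il; have k1 := key i l il.
have k2 : - (V l i * h i) < V l l * h l by apply: key; rewrite eq_sym.
have p1 : 0 <= - (V i l * h l) by rewrite oppr_ge0 mulr_ge0_le0 ?V0.
have p2 : 0 <= - (V l i * h i) by rewrite oppr_ge0 mulr_ge0_le0 ?V0 // eq_sym.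
have hi : h i < 0.
  by rewrite lt_neqAle h0 andbT; apply: contraTneq k1 => ->; rewrite mulr0 -leNgt.
have hl : h l < 0.
  by rewrite lt_neqAle h0 andbT; apply: contraTneq k2 => ->; rewrite mulr0 -leNgt.
have := ltr_pM p1 p2 k1 k2.
rewrite [ltLHS](_ : _ = V i l * V l i * (h i * h l)); last by ring.
rewrite [ltRHS](_ : _ = V i i * V l l * (h i * h l)); last by ring.
by rewrite ltr_pM2r; [exact: ltW | rewrite nmulr_rgt0].
Qed.

(** [T] minimises the distance from 0 to the remaining hull. If the hull remaining after another
    [T'] still contains [y], then [y] is its nearest point too and inherits the supporting
    inequality. *)
Lemma nearest_simplex (R : realType) n (v : 'I_n -> 'rV[R]_3) (X : {set 'I_n}) :
  deep v 3 X ->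
  (forall A : {set 'I_n}, A \subset X -> hull v A 0 -> ~ hull v (X :\: A) 0) ->
  exists (T : {set 'I_n}) y,
    [/\ T \subset X, #|T| = 4, minhull v T 0, hull v (X :\: T) y
      & forall T' : {set 'I_n}, T' \subset X -> #|T'| = 4 -> hull v T' 0 ->
          hull v (X :\: T') y -> forall i, i \in X :\: T' -> dot y y <= dot y (v i)].
Proof.
move=> dX no; have big := nosplit_card dX no.
have hX : hull v X 0 by apply: dX; rewrite // setDv cards0.
pose good (T : {set 'I_n}) := asbool [/\ T \subset X, #|T| = 4 & hull v T 0].
have [T0 T0X mT0] := minhull_exists hX.
have gT0 : good T0.
  apply/asboolP; split=> //; last exact: mT0.1.
  have := big _ T0X mT0.1.
  have := minhull_card (u := 0) mT0 (fun i _ => dot0l _).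
  by rewrite eqxx; lia.
have Yex (T : {set 'I_n}) : exists y, good T -> hull v (X :\: T) y /\
    forall i, i \in X :\: T -> dot y y <= dot y (v i).
  have [gT|] := boolP (good T); last by exists 0.
  have /asboolP[TX T4 hT] := gT.
  have [|y hy ymin] := @hull_min R 3 n v (X :\: T); last by exists y.
  (* If nothing remained, [X] would have at most four points, and deleting one would leave a hull of
     three containing 0. *)
  apply/eqP => XT; have [t tT] := hull_exists hT.
  have : hull v (X :\ t) 0.
    apply: dX; first exact: subsetDl.
    rewrite (_ : X :\: (X :\ t) = [set t]) ?cards1 //.
    by apply/setP => i; rewrite !inE; case: eqP => [->|_] /=;
      [rewrite (subsetP TX) | case: (i \in X)].
  move/(big _ (subsetDl _ _)); apply/negP; rewrite -leqNgt.
  have := subset_leq_card (_ : X \subset T); rewrite T4 (cardsD1 t X) (subsetP TX) //.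
  by rewrite add1n ltnS; apply; rewrite -setD_eq0 XT.
have [Y YP] := boolp.choice Yex.
case: (@arg_minP _ _ _ T0 good (fun T => dot (Y T) (Y T)) gT0) => T gT Tmin.
have /asboolP[TX T4 hT] := gT; have [hY _] := YP T gT.
exists T, (Y T); split=> //.
  split=> // T' T'T hT'; have := big T' (subset_trans (proper_sub T'T) TX) hT'.
  by have := proper_card T'T; rewrite T4; lia.
move=> T' T'X T'4 hT' hYT' i iT'.
have gT' : good T' by apply/asboolP.
have [hY' Y'min] := YP T' gT'.
have YY' := hull_ge hYT' Y'min.
suff -> : Y T = Y T' by apply: Y'min.
apply/eqP; rewrite -subr_eq0 -dot_eq0 eq_le dot_ge0 andbT.
rewrite dotBr !(dotC (_ - _)) !dotBr (dotC (Y T) (Y T')).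
have : dot (Y T) (Y T) <= dot (Y T') (Y T') := Tmin T' gT'.
lra.
Qed.

Lemma radon_depth3 (R : realType) n (v : 'I_n -> 'rV[R]_3) (X : {set 'I_n}) :
  deep v 3 X ->
  exists A : {set 'I_n}, [/\ A \subset X, hull v A 0 & hull v (X :\: A) 0].
Proof.
move=> dX; apply: contrapT => none.
have no (A : {set 'I_n}) : A \subset X -> hull v A 0 -> ~ hull v (X :\: A) 0.
  by move=> AX hA hXA; apply: none; exists A.
have big := nosplit_card dX no.
have [T [y [TX T4 mT hy near]]] := nearest_simplex dX no.
have ymin i : i \in X :\: T -> dot y y <= dot y (v i).
  exact: near TX T4 mT.1 hy i.
have y0 : y != 0 by apply/eqP => y0; apply: (no T TX mT.1); rewrite -[0]y0.
have yy : 0 < dot y y by rewrite lt_def dot_eq0 y0 dot_ge0.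
have ypos i : i \in X :\: T -> 0 < dot y (v i) by move/ymin; apply: lt_le_trans.
(* Otherwise [T] would lie in the plane orthogonal to [y] and have at most three points. *)
have [a aT ya] : exists2 a, a \in T & 0 < dot y (v a).
  apply: contrapT => na; have := minhull_card (u := y) mT; rewrite T4 y0.
  suff h i : i \in T -> dot y (v i) = 0 by move=> /(_ h).
  move=> iT; apply/oppr_inj; rewrite -dotNl (minhull_face mT) //.
    by rewrite dot0r oppr0.
  move=> j jT; rewrite dot0r dotNl oppr_ge0 leNgt; apply/negP => yj.
  by apply: na; exists j.
have D3 : #|T :\ a| = 3%N by move: T4; rewrite (cardsD1 a T) aT => -[].
(* With two vertices of [T] on the positive side, deleting the other two would leave a family
   separated from 0 by [y]. *)
have yT t : t \in T :\ a -> dot y (v t) <= 0.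
  move=> tT; rewrite leNgt; apply/negP => yt.
  have /hull_pos : hull v ((X :\: T) :|: [set a; t]) 0.
    apply: dX.
      rewrite !subUset !sub1set subsetDl (subsetP TX _ aT) (subsetP TX) //.
      by move: tT; rewrite inE => /andP[].
    have : (#|T :\ a :\ t| < 3)%N by move: D3; rewrite (cardsD1 t) tT add1n => -[->].
    apply: leq_ltn_trans; apply: subset_leq_card; apply/subsetP => i.
    rewrite !inE; case: (i \in X); case: (i \in T); case: (i == a);
      by case: (i == t).
  move=> /(_ y); apply=> i; rewrite !inE => /orP[|/orP[]/eqP-> //].
  by move=> iB; apply: ypos; rewrite inE.
pose e k := enum_val (cast_ord (esym D3) k).
have e_inj : injective e by move=> k l /enum_val_inj/cast_ord_inj.
have eT k : e k \in T :\ a by apply: enum_valP.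
have eT' k : e k \in T by have := eT k; rewrite inE => /andP[].
have ea k : e k != a by have := eT k; rewrite !inE => /andP[].
have Te t : t \in T -> t = a \/ exists k, t = e k.
  move=> tT; have [->|ta] := eqVneq t a; [by left|right].
  have tD : t \in T :\ a by rewrite !inE ta.
  exists (cast_ord D3 (enum_rank_in tD t)).
  by rewrite /e cast_ordK enum_rankK_in.
pose E := \matrix_k v (e k).
have Eu : E \in unitmx.
  by rewrite -row_free_unit; apply: minhull_row_free mT aT e_inj eT.
pose g i := v i *m invmx E.
have ge k l : g (e k) 0 l = (l == k)%:R.
  have -> : g (e k) = row k (1%:M : 'M[R]_3).
    by rewrite -(mulmxV Eu) row_mul rowK.
  by rewrite !mxE eq_sym.
have gE i : g i *m E = v i by rewrite /g mulmxKV.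
have gv i : v i = \sum_k g i 0 k *: v (e k).
  by rewrite -[LHS]gE mulmx_sum_row; apply: eq_bigr => k _; rewrite rowK.
have hullg (S : {set 'I_n}) : hull v S 0 -> hull g S 0 by apply: hull_mulmx.
have hullv (S : {set 'I_n}) : hull g S 0 -> hull v S 0.
  by move/(hull_mulmx E); rewrite (_ : (fun i => _) = v) //; apply/funext => i; apply: gE.
have mTg : minhull g T 0.
  split; first exact: hullg mT.1.
  by move=> T' T'T /hullv; apply: mT.2.
have ga : forall k, g a 0 k < 0 := minhull_coord_lt0 mTg aT e_inj eT Te ge.
have [B BX mB] := minhull_exists hy.
have BP i : i \in B -> [/\ i \in X, i \notin T & i \in X :\: T].
  by move=> /(subsetP BX); rewrite inE => /andP[iT iX]; split=> //; rewrite iT.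
(* Otherwise [i] could replace some [e j] in [T]. The points of [B] would remain, so [near] would
   apply to the freed [e j], where [dot y] is nonpositive. *)
have out i : i \in X :\: T -> i \notin B -> forall k, g i 0 k < 0.
  move=> iXT iB k; move: (iXT); rewrite inE => /andP[iT iX].
  rewrite ltNge; apply/negP => gik.
  have [j [p [q [u]]]] := octet_exchange ge ga gik; set T' := [set i; a; e p; e q].
  move=> /hullv hT'.
  have T'X : T' \subset X by rewrite !subUset !sub1set iX !(subsetP TX).
  have T'4 : #|T'| = 4.
    apply/eqP; rewrite eqn_leq (big T') // andbT.
    have sT' : T' \subset [:: i; a; e p; e q].
      by apply/subsetP => x; rewrite !inE -!orbA.
    exact: leq_trans (subset_leq_card sT') (card_size _).
  have hy' : hull v (X :\: T') y.
    apply: hullS mB.1; apply/subsetP => x xB; have [xX xT _] := BP x xB.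
    rewrite !inE xX andbT !negb_or; apply/andP; split; last by apply: contraNneq xT => ->.
    apply/andP; split; last by apply: contraNneq xT => ->.
    apply/andP; split; last by apply: contraNneq xT => ->.
    by apply: contraNneq iB => <-.
  have ejT' : e j \in X :\: T'.
    rewrite !inE (subsetP TX) // andbT !(inj_eq e_inj) (negPf (ea j)) orbF.
    move: u; rewrite /= !inE negb_or => /and3P[/andP[/negPf-> /negPf->] _ _].
    by rewrite !orbF; apply: contraNneq iT => <-.
  have := near T' T'X T'4 hT' hy' _ ejT'.
  by rewrite leNgt => /negP; apply; apply: le_lt_trans (yT _ (eT j)) yy.
(* Otherwise deleting [e k] and the set [N] leaves coordinate [k] nonpositive, vanishing only inside
   [T :\ a]; 0 would lie in the hull of at most three points. *)
have nneg2 k : (1 < #|[set i in B | (0 <= g i 0 k)%R]|)%N.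
  rewrite ltnNge; apply/negP; pose N : {set 'I_n} := [set i in B | 0 <= g i 0 k].
  move=> cN; have {cN} cN : (#|N| <= 1)%N := cN.
  pose S := X :\: (e k |: N).
  have hS : hull g S 0.
    apply/hullg/dX; first exact: subsetDl.
    have : X :\: S \subset e k |: N by rewrite setDDr setDv set0U subsetIr.
    move/subset_leq_card/leq_ltn_trans; apply.
    by rewrite cardsU1; case: (_ \notin _); lia.
  have cls i : i \in S -> g i 0 k < 0 \/ i \in T :\ a /\ g i 0 k = 0.
    rewrite !inE negb_or => /andP[/andP[iek iN] iX].
    have [/Te[->|[l il]]|iT] := boolP (i \in T); first by left.
      right; rewrite il ea ge; split=> //.
      by move: iek; rewrite il (inj_eq e_inj) eq_sym => /negPf->.
    left; have [iB|iB] := boolP (i \in B); last by apply: out; rewrite // inE iT.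
    by rewrite ltNge; move: iN; rewrite iB.
  have := hull_face (u := - delta_mx 0 k) hS.
  rewrite dot0r; set F := [set i in S | _] => hF.
  have /hullv/big : hull g F 0.
    apply: hF => i /cls; rewrite dotNl dot_delta oppr_ge0.
    by case=> [/ltW|[_ ->]].
  have FD : F \subset T :\ a.
    apply/subsetP => i; rewrite [i \in F]inE dotNl dot_delta oppr_eq0 => /andP[/cls].
    by case=> [/lt_eqF->|[]].
  have := subset_leq_card FD; rewrite D3 leqNgt => /negP F3 F4; apply: F3; apply: F4.
  by apply: subset_trans FD (subset_trans (subsetDl _ _) TX).
have negB i : i \in B -> exists k, g i 0 k < 0.
  move=> iB; apply: contrapT => nneg; have [_ _ /ypos] := BP i iB.
  apply/negP; rewrite -leNgt gv dot_sumr; apply: sumr_le0 => k _.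
  rewrite mulr_ge0_le0 ?yT // leNgt; apply/negP => gik.
  by apply: nneg; exists k.
(* By minimality [B] lies in the plane on which [dot y] equals [dot y y]. *)
have B3 : (#|B| <= 3)%N.
  have := minhull_card (u := y) (minhull_shift mB); rewrite y0 addn1 ltnS; apply.
  move=> i iB; rewrite dotBr (minhull_face mB) ?subrr // => j jB.
  by apply: ymin; have [] := BP j jB.
have [i0 i0B] := hull_exists mB.1.
have [b [bB gb gb' Bb]] := octet_points i0B B3 negB nneg2.
have bX k : b k \in X by have [] := BP _ (bB k).
have oct : octet g e b.
  split=> //; apply: (@octet_cross R (fun k l => g (b k) 0 l)
    (fun k => dot y (v (e k)))) => //.
    by move=> k; apply: yT.
  by move=> k; rewrite -dot_sumr -gv; apply: ypos; have [] := BP _ (bB k).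
(* Otherwise deleting [a] and [b 0] leaves coordinate 0 nonnegative, so 0 lies in the hull of a
   planar face, hence of at most three points. *)
have [a' a'XT a'B] : exists2 a', a' \in X :\: T & a' \notin B.
  apply: contrapT => na'.
  have XTB i : i \in X :\: T -> i \in B.
    by move=> iXT; apply: contrapT => /negP iB; apply: na'; exists i.
  pose S := X :\: [set a; b 0].
  have hS : hull g S 0.
    apply/hullg/dX; first exact: subsetDl.
    have : X :\: S \subset [set a; b 0] by rewrite setDDr setDv set0U subsetIr.
    by move/subset_leq_card/leq_ltn_trans; apply; rewrite cards2; case: (a != _).
  have S0 i : i \in S -> 0 <= g i 0 0.
    rewrite !inE negb_or => /andP[/andP[ia ib] iX].
    have [/Te[/eqP|[l ->]]|iT] := boolP (i \in T); first by rewrite (negPf ia).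
      by rewrite ge ler0n.
    have [l il] : exists l, i = b l by apply/Bb/XTB; rewrite inE iT.
    rewrite il gb' //; apply: contraNneq ib => l0; by rewrite il l0.
  have := hull_face (u := delta_mx 0 0) hS.
  rewrite dot0r; set F := [set i in S | _] => hF.
  have /minhull_exists[F' F'F mF'] : hull g F 0.
    by apply: hF => i iS; rewrite dot_delta S0.
  have F'X : F' \subset X.
    apply: subset_trans F'F _; apply/subsetP => i; rewrite !inE => /andP[/andP[]] //.
  have := big F' F'X (hullv _ mF'.1).
  have := minhull_card (u := delta_mx 0 0) mF'.
  have -> : (delta_mx 0 0 : 'rV[R]_3) != 0.
    apply/eqP => /rowP /(_ 0); rewrite !mxE !eqxx => /eqP; apply/negP.
    exact: oner_neq0.
  move=> h; have : (#|F'| + 1 <= 4)%N; last by lia.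
  by apply: h => i /(subsetP F'F); rewrite [i \in F]inE => /andP[_ /eqP].
move: (a'XT); rewrite inE => /andP[a'T a'X].
have aa' : a != a' by apply: contraNneq a'T => <-.
have eX k : e k \in X by apply: (subsetP TX).
have [A [AX hA hXA]] :=
  octet_radon oct ga (out _ a'XT a'B) aa' eX bX (subsetP TX _ aT) a'X.
by apply: none; exists A; split=> //; apply: hullv.
Qed.

(** * From depth to Tverberg partitions *)

(** Each step splits off one minimal simplex at a cost of 3 in depth; the base case, two parts at
    depth 3, is [radon_depth3]. *)
Lemma deep_tverberg (R : realType) n (v : 'I_n -> 'rV[R]_3) m (X : {set 'I_n}) :
  deep v (3 * m.+1) X ->
  exists f : 'I_n -> 'I_m.+2, forall j, hull v [set i in X | f i == j] 0.
Proof.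
elim: m X => [|m IH] X dX.
  have [A [AX hA hXA]] := radon_depth3 dX.
  exists (fun i => if i \in A then ord0 else lift ord0 ord0) => j.
  case: (unliftP ord0 j) => [j' ->|->].
    apply: hullS hXA; apply/subsetP => i; rewrite !inE => /andP[/negPf-> ->].
    by rewrite (ord1 j') eqxx.
  apply: hullS hA; apply/subsetP => i iA.
  by rewrite inE (subsetP AX) // iA eqxx.
have hX : hull v X 0 by apply: dX; rewrite // setDv cards0.
have [T TX mT] := minhull_exists hX.
have {}dX : deep v (3 * m.+1 + 3) X by rewrite addnC -mulnS.
have [f fP] := IH _ (deep_minhull dX TX mT).
exists (fun i => if i \in T then ord0 else lift ord0 (f i)) => j.
case: (unliftP ord0 j) => [j' ->|->].
  apply: hullS (fP j'); apply/subsetP => i.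
  by rewrite !inE => /andP[/andP[/negPf-> ->] /eqP->]; rewrite eqxx.
apply: hullS mT.1; apply/subsetP => i iT.
by rewrite inE (subsetP TX) // iT eqxx.
Qed.

Theorem theorem2 (R : realType) (m : nat) :
  (2 <= m)%N -> Tv_Zd_le R 3 m (24 * m - 31).
Proof.
case: m => [|[|m]] // _.
exists (24 * m.+2 - 31)%N; split=> // [|x]; first by lia.
(* With [m.+2] parts the required depth is [3 * m.+1], one more than [k = 3 * m + 2], and
   [8 * k + 1] is exactly [24 * m.+2 - 31]. *)
have [|p dp] := @centerpoint R 2 _ (3 * m + 2) x; first by lia.
have {}dp : deep (fun i => lat R (x i) - lat R p) (3 * m.+1) finset.setT.
  by rewrite (_ : 3 * m.+1 = (3 * m + 2).+1)%N //; lia.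
have [f fP] := deep_tverberg dp.
exists f, p => j.
have [w [w0 wf w1 wx]] := (hull_shift (fun i => lat R (x i)) _ (lat R p)).2 (fP j).
by exists w; split=> // i fij; apply: wf; rewrite !inE.
Qed.
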